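(* For $n\ge1$, the Eulerian polynomials satisfy $$A_n(x)=\sum_{T\in\mathrm{SYT}(n)}\left(\prod_{i=1}^n\sigma_i(T)\right)x^{n+1-\ell(\lambda(T))}=\sum_{T\in\mathrm{SYT}(n)}\left(\prod_{i=1}^n\sigma_i(T)\right)x^{\ell(\lambda(T))},$$ and the bivariate Eulerian polynomials have the expression $$A_{n+1}(x,y)=\sum_{T\in\mathrm{SYT}(n;2)}2^{w_2(T)}\left(\prod_{i=1}^n\sigma_i(T)\right)(xy)^{n+1-w_1(T)-w_2(T)}(x+y)^{w_1(T)},$$ where $w_i(T)$ is the number of rows in $T$ with $i$ elements.
   Context: $A_n(x)=\sum_{\pi\in\mathfrak S_n}x^{\mathrm{des}(\pi)+1}$ and $A_n(x,y)=\sum_{\pi\in\mathfrak S_n}x^{\mathrm{des}(\pi)+1}y^{n-\mathrm{des}(\pi)}$, where $\mathfrak S_n$ is the symmetric group on $[n]$ and $\mathrm{des}(\pi)=\#\{i\in[n-1]:\pi(i)>\pi(i+1)\}$. A standard Young tableau of size $n$ is a filling of the Ferrers diagram of a partition $\lambda\vdash n$ (French convention: left-justified rows numbered from bottom to top, $\lambda_i$ boxes in row $i$) with $1,\dots,n$, each used exactly once, increasing from left to right in rows and from bottom to top in columns; $\mathrm{SYT}(n)$ is the set of all of them, and $\mathrm{SYT}(n;k)$ is the subset of those with at most $k$ columns. For $T\in\mathrm{SYT}(n)$, $\ell(\lambda(T))$ is the number of rows of $T$, $T_i$ is the tableau obtained from $T$ by deleting the entries $i+1,\dots,n$, and $\mathrm{col}_k(T_i)$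 is the number of boxes in the $k$-th column of $T_i$. The box sorting index of $i$ is $$\sigma_i(T)=\begin{cases} i-\mathrm{col}_1(T_i)+1, & \text{if } i \text{ is in the first column of } T,\\ \mathrm{col}_k(T_i)-\mathrm{col}_{k+1}(T_i)+1, & \text{if } i \text{ is in the } (k+1)\text{-th column of } T,\ k\ge1.\end{cases}$$ *)

(* Defs.v *)
From mathcomp Require Import all_boot all_order all_fingroup all_algebra.
From mathcomp Require Import mpoly.

Set Implicit Arguments.
Unset Strict Implicit.
Unset Printing Implicit Defensive.

Definition des (n : nat) (p : 'S_n) : nat :=
  #|[set i : 'I_n | [exists j : 'I_n, (j == i.+1 :> nat) && (p j < p i)]]|.

Section Eulerian.
Local Open Scope ring_scope.

Definition eulerian (n : nat) : {poly int} :=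
  \sum_(p : 'S_n) 'X ^+ (des p).+1.

(* The variables x and y are 'X_0 and 'X_1. *)
Definition eulerian2 (n : nat) : {mpoly int[2]} :=
  \sum_(p : 'S_n) 'X_0 ^+ (des p).+1 * 'X_1 ^+ (n - des p).

End Eulerian.

(* A tableau is the sequence of its rows from bottom to top (French           *)
(* convention). Entries are 1, ..., n, whereas rows and columns are numbered  *)
(* from 0: column k below is the (k+1)-th column.                             *)

Definition is_part (n : nat) (lam : seq nat) : bool :=
  [&& sorted geq lam, 0 \notin lam & sumn lam == n].

Definition column (t : seq (seq nat)) (k : nat) : seq nat :=
  [seq nth 0 u k | u <- t & k < size u].

(* A partition of n has at most n columns, so k < n covers them all. *)
Definition is_syt (n : nat) (t : seq (seq nat)) : bool :=
  [&& is_part n (shape t), perm_eq (flatten t) (iota 1 n),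
      all (sorted ltn) t & all (fun k => sorted ltn (column t k)) (iota 0 n)].

Definition nrows (t : seq (seq nat)) : nat := size (shape t).

(* The bottom row is the longest one. *)
Definition ncols (t : seq (seq nat)) : nat := head 0 (shape t).

Definition nrows_of_size (k : nat) (t : seq (seq nat)) : nat :=
  count_mem k (shape t).

Definition restrict (i : nat) (t : seq (seq nat)) : seq (seq nat) :=
  [seq u <- [seq [seq j <- u | j <= i] | u <- t] | u != [::]].

Definition col (k : nat) (t : seq (seq nat)) : nat := size (column t k).

(* The column containing i is given by the rank of i within its row. *)
Definition col_index (t : seq (seq nat)) (i : nat) : nat :=
  index i (nth [::] t (find (fun u : seq nat => i \in u) t)).

(* Both subtractions are exact on standard Young tableaux: a column of T_i    *)
(* has at most i boxes, and column lengths weakly decrease.                   *)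
Definition sigma (t : seq (seq nat)) (i : nat) : nat :=
  let ti := restrict i t in
  if col_index t i is k.+1 then (col k ti - col k.+1 ti).+1
  else (i - col 0 ti).+1.

(* A standard Young tableau of size n has at most n rows, of at most n boxes  *)
(* each; bounded sequences only serve to make SYT n a set over a finite type. *)
Definition rows (n : nat) (T : n.-bseq (n.-bseq 'I_n.+1)) : seq (seq nat) :=
  [seq [seq val j | j <- val u] | u <- val T].

Definition SYT (n : nat) : {set n.-bseq (n.-bseq 'I_n.+1)} :=
  [set T | is_syt n (rows T)].

Definition SYT_le (n k : nat) : {set n.-bseq (n.-bseq 'I_n.+1)} :=
  [set T in SYT n | ncols (rows T) <= k].

(* The bounds lose nothing: SYT n is in bijection with is_syt n. *)
Lemma rows_inj (n : nat) : injective (@rows n).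
Proof.
by move=> S T eqST; apply/val_inj/(inj_map _ eqST) => u v /(inj_map val_inj)/val_inj.
Qed.

Lemma rows_surj (n : nat) (t : seq (seq nat)) :
  is_syt n t -> exists2 T, T \in SYT n & rows T = t.
Proof.
move=> tP; case/and4P: (tP) => /and3P[_ t0 /eqP tn] tperm _ _.
have row_le u : u \in t -> size u <= n.
  rewrite -tn => /(map_f size); rewrite -/(shape t); elim: (shape t) => [|a s IHs] //=.
  rewrite inE => /predU1P[->|/IHs les]; first exact: leq_addr.
  exact: leq_trans les (leq_addl _ _).
have ent_le u j : u \in t -> j \in u -> j < n.+1.
  move=> ut ju; have: j \in flatten t by apply/flattenP; exists u.
  by rewrite (perm_mem tperm) mem_iota add1n => /andP[].
have size_le : size t <= n.
  rewrite -tn -(size_map size t) -/(shape t).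
  elim: (shape t) t0 => [|a s IHs] //=.
  rewrite inE negb_or => /andP[a0 /IHs sle].
  by rewrite -add1n leq_add // lt0n eq_sym.
pose f (u : seq nat) : n.-bseq 'I_n.+1 :=
  insub_bseq n [seq inord j | j <- u].
have fK u : u \in t -> [seq val j | j <- val (f u)] = u.
  move=> ut; rewrite /f /insub_bseq val_insubd size_map row_le // -map_comp.
  by apply: map_id_in => j ju /=; rewrite inordK // (ent_le u).
have rT : rows (insub_bseq n [seq f u | u <- t]) = t.
  rewrite /rows /insub_bseq val_insubd size_map size_le -map_comp.
  by apply: map_id_in => u /fK.
by exists (insub_bseq n [seq f u | u <- t]); rewrite // inE rT.
Qed.

(* Main.v *)
From HB Require Import structures.
Require Import Defs.
From mathcomp Require Import all_boot all_order all_fingroup all_algebra.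
From mathcomp Require Import mpoly.
From mathcomp Require Import zify ring.

(** The three formulas are instances of one expansion. Let D be a derivation
    of a commutative ring, c an element of it, and c_k = D^k c. Applying the
    operator f |-> c * D f to a monomial c^(m+1-l) * c_(lambda_1) ...
    c_(lambda_l), for a partition lambda of m into l parts, gives by the
    Leibniz rule the following terms:
    - D hits one of the m+1-l factors c: a part 1 is created, that is, a box is
      added on top of the first column, with coefficient m+1-l;
    - D hits one of the factors c_k: a part k becomes k+1, that is, a box is
      added to column k+1, with coefficient the number of parts equal to k,
      which is the number of boxes of column k minus that of column k+1.
    These coefficients are the values sigma of the box just added, so recording
    the order in which the boxes appear gives
      (cD)^n c = \sum_T (\prod_i sigma_i(T)) * c^(n+1-l(T)) * \prod_j c_(lambda_j),
    the sum being over the standard tableaux T of size n; this is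
    [iter_derivation_SYT].

    On the other side, inserting n+1 into the permutations of [n] shows that
    A_(n+1)(x,y) = E A_n(x,y) with E = xy(d/dx + d/dy) ([eulerian2_rec]), so
    A_n = E^n x. The operator E factors as c D in several ways:
    - c = x and D = y(d/dx + d/dy), for which all the c_k with k > 0 are y;
      setting y = 1 gives the first formula;
    - c = y and D = x(d/dx + d/dy), with x and y exchanged; since E x = E y, the
      same A_n is obtained when n > 0, and setting y = 1 gives the second one;
    - c = xy and D = d/dx + d/dy, for which the c_k are xy, x + y, 2, 0, 0, ...;
      since xy = E x, the left-hand side is now A_(n+1), and only the tableaux
      with at most two columns contribute. This is the third formula. *)

Set Implicit Arguments.
Unset Strict Implicit.
Unset Printing Implicit Defensive.

Import GRing.Theory.

(** * Standard tableaux as sequences of rows compared pairwise *)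

(** Recursion on the list of rows compares one row with those above it, whereas
    the columns cut across all of them: this relation carries the column
    condition, and the decrease of the row lengths, row by row. *)
Definition below (u v : seq nat) : bool :=
  (size v <= size u) && all (fun k => nth 0 u k < nth 0 v k) (iota 0 (size v)).

Definition standard (t : seq (seq nat)) : bool :=
  [&& [::] \notin t, all (sorted ltn) t & pairwise below t].

Lemma belowP u v :
  reflect (size v <= size u /\ forall k, k < size v -> nth 0 u k < nth 0 v k)
          (below u v).
Proof.
apply: (iffP andP) => -[le_vu uv]; split=> //.
  by move=> k k_lt; apply: (allP uv); rewrite mem_iota.
by apply/allP => k; rewrite mem_iota => /uv.
Qed.

Lemma size_row_le (t : seq (seq nat)) v : v \in t -> size v <= size (flatten t).
Proof.
elim: t => //= u t IHt; rewrite inE size_cat => /predU1P[->|/IHt le_v].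
  exact: leq_addr.
exact: leq_trans le_v (leq_addl _ _).
Qed.

Lemma column_cons u t k :
  column (u :: t) k = if k < size u then nth 0 u k :: column t k else column t k.
Proof. by rewrite /column /=; case: ifP. Qed.

Lemma nth_in_column (t : seq (seq nat)) v k :
  v \in t -> k < size v -> nth 0 v k \in column t k.
Proof.
by move=> vt k_lt; apply: (map_f (fun u => nth 0 u k)); rewrite mem_filter k_lt.
Qed.

(** A column is sorted as soon as its pairs of entries are, and a pair of
    entries of a column lies in a pair of rows. *)
Lemma sorted_columnsE N t : (forall v, v \in t -> size v <= N) ->
  sorted geq (shape t) && all (fun k => sorted ltn (column t k)) (iota 0 N)
    = pairwise below t.
Proof.
have geq_trans : transitive geq.
  by move=> m n p /= le_mn le_pm; apply: leq_trans le_pm le_mn.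
rewrite (sorted_pairwise geq_trans).
under eq_all => k do rewrite (sorted_pairwise ltn_trans).
elim: t => [|u t IHt] le_t; first by apply/andP; split=> //; apply/allP.
rewrite [RHS]/= -IHt => [|v vt]; last by apply: le_t; rewrite inE vt orbT.
rewrite [shape _]/= pairwise_cons -andbA.
apply/and3P/and3P => [[/allP le_u -> /allP cols]|[/allP below_u -> /allP cols]].
  split=> //; last first.
    apply/allP => k /cols; rewrite column_cons.
    by case: ifP => // _; rewrite pairwise_cons => /andP[].
  apply/allP => v vt; have le_vu := le_u _ (map_f size vt).
  apply/belowP; split=> // k k_lt.
  have/cols: k \in iota 0 N.
    by rewrite mem_iota (leq_trans k_lt) // le_t // inE vt orbT.
  rewrite column_cons (leq_trans k_lt le_vu) pairwise_cons => /andP[/allP + _].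
  by apply; apply: nth_in_column.
split=> //; first by apply/allP => _ /mapP[v /below_u/belowP[le_vu _] ->].
apply/allP => k /cols col_k; rewrite column_cons; case: ifP => // k_lt.
rewrite pairwise_cons col_k andbT; apply/allP => _ /mapP[v + ->].
by rewrite mem_filter => /andP[k_ltv /below_u/belowP[_]]; apply.
Qed.

Lemma is_sytE n t :
  is_syt n t = standard t && perm_eq (flatten t) (iota 1 n).
Proof.
rewrite /is_syt /is_part /standard -size_flatten.
case tn: (perm_eq _ _); last by rewrite !andbF.
have sz_t := perm_size tn; rewrite size_iota in sz_t.
rewrite -(@sorted_columnsE n) => [|v /size_row_le]; last by rewrite sz_t.
have -> : (0 \in shape t) = ([::] \in t).
  apply/mapP/idP => [[u ut /esym/size0nil <-] //|t0].
  by exists [::].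
rewrite sz_t eqxx !andbT /=.
by case: sorted; case: (_ \in _); case: all; case: all.
Qed.

(** Row lengths weakly decrease upwards, so a box can only be added to the
    column of index [k] at the end of the lowest row of length at most [k]. The
    box is specified by its column, and not by its row, because sigma is. *)
Fixpoint add_box (k m : nat) (t : seq (seq nat)) : seq (seq nat) :=
  if t is u :: t' then
    if size u <= k then rcons u m :: t' else u :: add_box k m t'
  else [:: [:: m]].

(** The columns where a box can be added: the first one, where a new row starts,
    and the one that follows the end of some row. *)
Definition addable (t : seq (seq nat)) : seq nat := undup (0 :: shape t).

Lemma perm_flatten_add k m t : perm_eq (flatten (add_box k m t)) (m :: flatten t).
Proof.
elim: t => [|u t IHt] //=; case: ifP => _ /=.
  by rewrite cat_rcons perm_catC /= perm_cons perm_catC.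
by rewrite (permPl (perm_cat (perm_refl u) IHt)) perm_catC /= perm_cons perm_catC.
Qed.

Lemma mem_add k m t v : v \in add_box k m t ->
  v \in t \/ exists2 w, (w \in [::] :: t) && (size w <= k) & v = rcons w m.
Proof.
elim: t => [|u t IHt] /=.
  by rewrite inE => /eqP->; right; exists [::].
case: ifP => le_uk; rewrite !inE => /predU1P[->|].
- by right; exists u; rewrite // !inE eqxx orbT.
- by move=> ->; left; rewrite orbT.
- by rewrite eqxx; left.
case/IHt => [->|[w]]; first by left; rewrite orbT.
rewrite inE => /andP[w_in le_wk] ->; right; exists w; rewrite // !inE le_wk andbT.
by case/orP: w_in => ->; rewrite ?orbT.
Qed.

Lemma standard_cons u t :
  standard (u :: t) = [&& u != [::], sorted ltn u, all (below u) t & standard t].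
Proof.
rewrite /standard inE negb_or eq_sym /=.
by case: (u != _) (_ \in _) (sorted _ _) (all _ _) (all _ _) => [] [] [] [] [].
Qed.

Lemma below_rcons u w m : (forall j, j \in u -> j < m) -> below u w ->
  size w < size u -> below u (rcons w m).
Proof.
move=> u_lt /belowP[_ uw] w_lt; apply/belowP; rewrite size_rcons; split=> // k.
rewrite ltnS leq_eqVlt nth_rcons => /predU1P[->|k_lt]; last by rewrite k_lt uw.
by rewrite ltnn eqxx u_lt // mem_nth.
Qed.

Lemma below_of_rcons u w m : below u (rcons w m) -> below u w.
Proof.
move=> /belowP[]; rewrite size_rcons => lt_wu uw; apply/belowP; split=> [|k k_lt].
  exact: ltnW.
by have:= uw k (ltnW k_lt); rewrite nth_rcons k_lt.
Qed.

Lemma sorted_rcons_ltn u m :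
  sorted ltn (rcons u m) = all (fun j => j < m) u && sorted ltn u.
Proof. by rewrite !(sorted_pairwise ltn_trans) pairwise_rcons. Qed.

(** Appending a maximal entry to the lowest row of length at most [k] keeps the
    tableau standard for every [k], because all the rows below have more than
    [k] entries. *)
Lemma standard_add k m t : standard t -> (forall j, j \in flatten t -> j < m) ->
  standard (add_box k m t).
Proof.
elim: t => [//|u t IHt]; rewrite standard_cons => /and4P[u0 u_sort ut t_std] lt_m /=.
have lt_mu j : j \in u -> j < m by move=> ju; rewrite lt_m //= mem_cat ju.
have lt_mt j : j \in flatten t -> j < m by move=> jt; rewrite lt_m //= mem_cat jt orbT.
have std_t' := IHt t_std lt_mt.
case: ifP => [_|/negbT]; rewrite standard_cons.
  rewrite t_std sorted_rcons_ltn u_sort !andbT /= -size_eq0 size_rcons /=.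
  apply/andP; split; first exact/allP.
  apply: sub_all ut => v /belowP[le_vu uv]; apply/belowP.
  rewrite size_rcons (leqW le_vu); split=> // j j_lt.
  by rewrite nth_rcons (leq_trans j_lt) // uv.
rewrite -ltnNge u0 u_sort std_t' andbT /= => lt_ku.
apply/allP => v /mem_add[/(allP ut)//|[w /andP[w_in le_wk] ->]].
apply: below_rcons => //; last exact: leq_ltn_trans le_wk lt_ku.
by move: w_in; rewrite inE => /predU1P[-> //|/(allP ut)].
Qed.

Lemma mem_addable k t : (k \in addable t) = (k == 0) || (k \in shape t).
Proof. by rewrite mem_undup inE. Qed.

Lemma addable_head u t k : standard (u :: t) -> k \in addable (u :: t) ->
  size u <= k -> size u = k.
Proof.
rewrite standard_cons mem_addable inE => /and4P[_ _ /allP ut _] + le_uk.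
case/or3P => [/eqP k0|/eqP //|/mapP[v /ut/belowP[+ _] k_v]].
  by apply/eqP; rewrite eqn_leq le_uk k0.
by rewrite -k_v => le_ku; apply/eqP; rewrite eqn_leq le_uk.
Qed.

Lemma addable_tail u t k : k \in addable (u :: t) -> (size u <= k) = false ->
  k \in addable t.
Proof.
by rewrite !mem_addable inE => /or3P[->|/eqP->|->]; rewrite ?leqnn ?orbT.
Qed.

Lemma standard_tail u t : standard (u :: t) -> standard t.
Proof. by rewrite standard_cons => /and4P[]. Qed.

(** On the multiset of row lengths, adding a box is the move k |-> k+1 made by
    the Leibniz rule. For k = 0 the list has no 0 to be removed, and a part 1
    appears. *)
Lemma perm_shape_add k m t : standard t -> k \in addable t ->
  perm_eq (shape (add_box k m t)) (k.+1 :: rem k (shape t)).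
Proof.
elim: t => [_|u t IHt std_t k_add] /=.
  by rewrite mem_addable orbF => /eqP->.
case: ifP => [/(addable_head std_t k_add) <-|lt_ku] /=.
  by rewrite size_rcons eqxx.
case: eqP => [u_k|_]; first by rewrite u_k leqnn in lt_ku.
have := IHt (standard_tail std_t) (addable_tail k_add lt_ku).
rewrite -(perm_cons (size u)) => /permPl->.
by apply/permPl; apply: (perm_catCA [:: _] [:: _]).
Qed.

Lemma restrict_cons i u t :
  restrict i (u :: t) =
    let v := [seq j <- u | j <= i] in
    if v != [::] then v :: restrict i t else restrict i t.
Proof. by []. Qed.

Lemma restrict_id i t : [::] \notin t -> (forall j, j \in flatten t -> j <= i) ->
  restrict i t = t.
Proof.
elim: t => //= u t IHt; rewrite inE negb_or eq_sym => /andP[u0 t0] le_i.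
have /all_filterP uE : all (fun j => j <= i) u.
  by apply/allP => j ju; rewrite le_i // mem_cat ju.
rewrite restrict_cons /= uE u0 IHt // => j jt.
by rewrite le_i // mem_cat jt orbT.
Qed.

Lemma restrict_add i k m t : i < m -> restrict i (add_box k m t) = restrict i t.
Proof.
move=> lt_im; have m_out : (m <= i) = false by rewrite leqNgt lt_im.
elim: t => [|u t IHt] /=; first by rewrite restrict_cons /= m_out.
by case: ifP => _; rewrite !restrict_cons ?IHt //= filter_rcons m_out.
Qed.

Lemma col_index_cons u t i :
  col_index (u :: t) i = if i \in u then index i u else col_index t i.
Proof. by rewrite /col_index /=; case: ifP. Qed.

Lemma col_index_add_old k m t i : i != m -> col_index (add_box k m t) i = col_index t i.
Proof.
move=> i_m; elim: t => [|u t IHt] /=.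
  by rewrite col_index_cons inE (negPf i_m).
case: ifP => _; rewrite !col_index_cons ?IHt // mem_rcons inE (negPf i_m) /=.
by case: ifP => // iu; rewrite -cats1 index_cat iu.
Qed.

Lemma col_index_add k m t : standard t -> k \in addable t -> m \notin flatten t ->
  col_index (add_box k m t) m = k.
Proof.
elim: t => [_|u t IHt std_t k_add] /=.
  by rewrite mem_addable orbF /col_index /= inE !eqxx /= eqxx => /eqP->.
rewrite mem_cat negb_or => /andP[mu mt].
case: ifP => [/(addable_head std_t k_add) <-|lt_ku]; rewrite col_index_cons.
  by rewrite mem_rcons mem_head -cats1 index_cat (negPf mu) /= eqxx addn0.
by rewrite (negPf mu) IHt ?(standard_tail std_t) ?(addable_tail k_add lt_ku).
Qed.

Lemma colE j t : Defs.col j t = count (fun s => j < s) (shape t).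
Proof. by rewrite /Defs.col size_map size_filter count_map. Qed.

Lemma col_first t : [::] \notin t -> Defs.col 0 t = size t.
Proof.
rewrite colE count_map => t0; rewrite -[RHS]count_predT; apply: eq_in_count => u ut.
by rewrite /= lt0n size_eq0; apply: contraNneq t0 => <-.
Qed.

(** The difference of two consecutive column lengths is the number of rows that
    end between them. *)
Lemma col_diff k t : Defs.col k t = Defs.col k.+1 t + count_mem k.+1 (shape t).
Proof.
by rewrite !colE; elim: (shape t) => //= s l ->; case: (ltngtP k.+1 s); lia.
Qed.

Lemma col_add j k m t : standard t -> k \in addable t ->
  Defs.col j (add_box k m t) = Defs.col j t + (j == k).
Proof.
move=> std_t k_add; rewrite !colE (seq.permP (perm_shape_add m std_t k_add)) /=.
case kt: (k \in shape t); first by rewrite (seq.permP (perm_to_rem kt)) /=; lia.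
rewrite rem_id ?kt //; move: k_add; rewrite mem_addable kt orbF => /eqP->; lia.
Qed.

Lemma sigma_add_old k m t i : i < m -> sigma (add_box k m t) i = sigma t i.
Proof.
by move=> lt_im; rewrite /sigma restrict_add // col_index_add_old // ltn_eqF.
Qed.

(** The value of sigma at the new box is the multiplicity with which the Leibniz
    rule produces it: the number of factors that can be differentiated so as to
    yield this box. *)
Lemma sigma_add k m t : standard t -> (forall j, j \in flatten t -> j < m) ->
  size t < m -> k \in addable t ->
  sigma (add_box k m t) m = if k == 0 then m - size t else count_mem k (shape t).
Proof.
move=> std_t lt_m szt k_add; rewrite /sigma restrict_id; last 2 first.
- by have /and3P[] := standard_add k std_t lt_m.
- by move=> j; rewrite (perm_mem (perm_flatten_add k m t)) inE => /predU1P[->|/lt_m/ltnW].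
rewrite col_index_add //; last by apply/negP => /lt_m; rewrite ltnn.
case: k k_add => [|k] k_add; rewrite !col_add //=.
  have /and3P[t0 _ _] := std_t.
  by rewrite col_first // addn1 subnS prednK // subn_gt0.
rewrite (ltn_eqF (ltnSn k)) eqxx col_diff.
by move: k_add; rewrite mem_addable -has_pred1 has_count /=; lia.
Qed.

(** The largest entry ends its row, and nothing stands above it, so deleting it
    leaves a standard tableau. The induction is on the rows; the only case where
    a row disappears is that of a top row consisting of [m] alone. *)
Lemma standard_remove_max m t' : standard t' -> uniq (flatten t') ->
  (forall j, j \in flatten t' -> j <= m) -> m \in flatten t' ->
  exists t k, [/\ t' = add_box k m t, standard t & k \in addable t].
Proof.
elim: t' => // u t IHt std_ut /=; rewrite cat_uniq => /and3P[u_uniq ut_disj t_uniq] le_m.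
have [u0 u_sort ut t_std] := and4P (etrans (esym (standard_cons u t)) std_ut).
have le_mt j : j \in flatten t -> j <= m by move=> jt; rewrite le_m // mem_cat jt orbT.
case mu: (m \in u); rewrite mem_cat mu /= => m_in; last first.
  have [s [k [tE s_std k_add]]] := IHt t_std t_uniq le_mt m_in.
  have kE : k.+1 \in shape t.
    by rewrite tE (perm_mem (perm_shape_add m s_std k_add)) mem_head.
  have lt_ku : k < size u.
    by case/mapP: kE => v /(allP ut)/belowP[le_vu _] ->.
  exists (u :: s), k; rewrite /= leqNgt lt_ku -tE mem_addable inE.
  split=> //; last by move: k_add; rewrite mem_addable => /orP[|]->; rewrite ?orbT.
  rewrite standard_cons u0 u_sort s_std andbT; apply/allP => v vs.
  have [vt|vt] : v \in t \/ rcons v m \in t.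
    rewrite tE; elim: (s) vs => //= w s' IHs; rewrite inE; case: ifP => _; rewrite !inE.
      by case/predU1P => [->|->]; [right; rewrite eqxx | left; rewrite orbT].
    by case/predU1P => [->|/IHs[]->]; rewrite ?eqxx ?orbT; auto.
  - exact: (allP ut).
  exact: below_of_rcons (allP ut _ vt).
case/lastP: u u0 u_sort ut std_ut mu u_uniq ut_disj le_m {m_in} => // u a _.
rewrite sorted_rcons_ltn => /andP[/allP lt_a u_sort] ut std_ut mu _ ut_disj le_m.
have a_m : a = m.
  apply/eqP; rewrite eqn_leq le_m ?mem_cat ?mem_rcons ?mem_head //=.
  by move: mu; rewrite mem_rcons inE => /predU1P[->|/lt_a/ltnW].
(* If [m] is alone in its row, no row stands above, since its first entry *)
(* would exceed the maximum [m]; the whole row is then removed.            *)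
subst a; case: (u =P [::]) => [u0|/eqP u0].
  exists [::], 0; split=> //; rewrite u0.
  case: t ut {IHt std_ut ut_disj} t_std le_m le_mt {t_uniq} => //= v t.
  move=> /andP[/belowP[_ uv] _]; rewrite standard_cons => /and4P[v0 _ _ _] _ le_m.
  have v_gt0 : 0 < size v by rewrite lt0n size_eq0.
  have := uv 0 v_gt0; rewrite u0 /= ltnNge le_m //.
  by rewrite mem_cat mem_nth.
exists (u :: t), (size u); rewrite /= leqnn mem_addable inE eqxx orbT; split=> //.
rewrite standard_cons u0 u_sort t_std andbT /=; apply/allP => v vt.
have /belowP[] := allP ut _ vt; rewrite size_rcons => le_vu uv.
have m_v : m \notin v.
  apply: contra ut_disj => m_v; apply/hasP; exists m; last by rewrite mem_rcons mem_head.
  by apply/flattenP; exists v.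
have le_vm j : j < size v -> nth 0 v j < m.
  move=> j_lt; have jv := mem_nth 0 j_lt; rewrite ltn_neqAle; apply/andP; split.
    by apply: contraNneq m_v => <-.
  by apply: le_mt; apply/flattenP; exists v.
(* A row above is not longer than [u], for its entry above [m] would exceed *)
(* [m].                                                                      *)
have le_v_u : size v <= size u.
  rewrite leqNgt; apply/negP => lt_uv.
  by have := ltn_trans (uv _ lt_uv) (le_vm _ lt_uv); rewrite nth_rcons ltnn eqxx ltnn.
apply/belowP; split=> // j j_lt; have := uv j j_lt.
by rewrite nth_rcons (leq_trans j_lt).
Qed.

(** * Enumeration of standard tableaux by successive box additions *)

Fixpoint syts (n : nat) : seq (seq (seq nat)) :=
  if n is m.+1 then [seq add_box k m.+1 t | t <- syts m, k <- addable t]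
  else [:: [::]].

Lemma mem_flatten_syt n t j : is_syt n t -> (j \in flatten t) = (0 < j <= n).
Proof.
by rewrite is_sytE => /andP[_ /perm_mem->]; rewrite mem_iota add1n ltnS.
Qed.

Lemma mem_syts n t : (t \in syts n) = is_syt n t.
Proof.
elim: n t => [|n IHn] t.
  rewrite is_sytE inE; apply/eqP/andP => [->//|[]].
  case: t => //= u t; rewrite standard_cons -size_eq0 => /and4P[u0 _ _ _] /perm_size.
  by rewrite size_cat; case: (size u) u0.
have iota_rcons : perm_eq (iota 1 n.+1) (n.+1 :: iota 1 n).
  by rewrite -{1}(addn1 n) iotaD perm_catC.
apply/allpairsPdep/idP => [[s [k [+ k_add ->]]]|].
  rewrite IHn is_sytE => s_syt; have /andP[s_std s_perm] := s_syt.
  rewrite is_sytE standard_add => // [|j]; last first.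
    by rewrite (mem_flatten_syt _ (etrans (is_sytE _ _) s_syt)) ltnS => /andP[].
  rewrite (permPl (perm_flatten_add _ _ _)) (permPr iota_rcons).
  by rewrite perm_cons.
move=> t_syt; move: (t_syt); rewrite is_sytE => /andP[t_std t_perm].
have [|j||s [k [tE s_std k_add]]] := standard_remove_max (m := n.+1) t_std.
- by rewrite (perm_uniq t_perm) iota_uniq.
- by rewrite (mem_flatten_syt _ t_syt) => /andP[].
- by rewrite (mem_flatten_syt _ t_syt) leqnn.
exists s, k; split=> //; rewrite IHn is_sytE s_std -(perm_cons n.+1).
rewrite -(permPr iota_rcons) -(permPr t_perm) tE perm_sym.
exact: perm_flatten_add.
Qed.

(** The last step of the growth can be read off the tableau: [restrict] recovers
    the previous tableau and [col_index] the column. *)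
Lemma syts_uniq n : uniq (syts n).
Proof.
elim: n => //= n IHn; apply: allpairs_uniq_dep => // [t _|]; first exact: undup_uniq.
move=> _ s /allpairsPdep[t1 [k1 [t1_in k1_in ->]]].
case/allpairsPdep=> t2 [k2 [t2_in k2_in ->]].
rewrite /= => add12.
have restrict_syt t : t \in syts n -> restrict n t = t.
  rewrite mem_syts => t_syt; move: (t_syt); rewrite is_sytE => /andP[/and3P[t0 _ _] _].
  by apply: restrict_id => // j; rewrite (mem_flatten_syt _ t_syt) => /andP[].
have max_out t : t \in syts n -> n.+1 \notin flatten t.
  by rewrite mem_syts => /mem_flatten_syt->; rewrite ltnn andbF.
have std t : t \in syts n -> standard t.
  by rewrite mem_syts is_sytE => /andP[].
have t12 : t1 = t2.
  rewrite -(restrict_syt t1) // -(restrict_syt t2) //.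
  by rewrite -(restrict_add k1 t1 (ltnSn n)) add12 restrict_add.
move: add12; rewrite t12 in k1_in *; move/(congr1 (col_index^~ n.+1)).
by rewrite !col_index_add ?std ?max_out // => ->.
Qed.

Local Open Scope ring_scope.

Lemma sum_SYT (V : nmodType) n (F : seq (seq nat) -> V) :
  \sum_(T in SYT n) F (rows T) = \sum_(t <- syts n) F t.
Proof.
rewrite -(big_image _ _ (@rows n)) /=; apply/perm_big/uniq_perm.
- by rewrite map_inj_uniq ?enum_uniq //; apply: rows_inj.
- exact: syts_uniq.
move=> t; rewrite mem_syts; apply/imageP/idP => [[T + ->]|/rows_surj[T T_in <-]].
  by rewrite inE.
by exists T.
Qed.

(** * Derivations and the expansion of (cD)^n c *)

Definition derivation (A : comNzRingType) (D : A -> A) : Prop :=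
  (forall f g, D (f + g) = D f + D g) /\
  (forall f g, D (f * g) = D f * g + f * D g).

Lemma derivation0 (A : comNzRingType) (D : A -> A) : derivation D -> D 0 = 0.
Proof. by case=> DD _; apply: (addrI (D 0)); rewrite -DD !addr0. Qed.

Lemma derivation_sum (A : comNzRingType) (D : A -> A) (I : Type) (r : seq I) F :
  derivation D -> D (\sum_(i <- r) F i) = \sum_(i <- r) D (F i).
Proof. by move=> dD; apply: big_morph; [case: dD | apply: derivation0]. Qed.

Lemma derivationMn (A : comNzRingType) (D : A -> A) f n :
  derivation D -> D (f *+ n) = D f *+ n.
Proof.
move=> dD; elim: n => [|n IHn]; first by rewrite !mulr0n derivation0.
by case: dD => DD _; rewrite !mulrS DD IHn.
Qed.

Lemma derivation1 (A : comNzRingType) (D : A -> A) : derivation D -> D 1 = 0.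
Proof.
by case=> _ DM; apply: (addrI (D 1)); rewrite addr0 -{3}(mulr1 1) DM mulr1 mul1r.
Qed.

Lemma derivationX (A : comNzRingType) (D : A -> A) f n :
  derivation D -> D (f ^+ n) = D f * f ^+ n.-1 *+ n.
Proof.
move=> dD; elim: n => [|n IHn]; first by rewrite expr0 derivation1 // mulr0n.
have [_ DM] := dD; rewrite exprS DM IHn; case: n {IHn} => [|n] /=.
  by rewrite expr0 mulr0n mulr0 addr0 mulr1.
by rewrite exprS mulrS; ring.
Qed.

(** Leibniz rule, with the terms obtained from equal factors collected. *)
Lemma derivation_prod (A : comNzRingType) (D : A -> A) (c : nat -> A) l :
    derivation D -> (forall k, D (c k) = c k.+1) ->
  D (\prod_(s <- l) c s)
    = \sum_(k <- undup l) (c k.+1 * \prod_(s <- rem k l) c s) *+ count_mem k l.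
Proof.
move=> dD Dc; rewrite (big_undup_iterop_count _ l xpredT).
elim: l => [|a l IHl]; first by rewrite !big_nil derivation1.
have [_ DM] := dD; rewrite !big_cons /= eqxx DM Dc IHl mulr_sumr; congr (_ + _).
apply: eq_big_seq => k kl; case: eqP => [->|_]; last by rewrite big_cons mulrCA.
by rewrite mulrCA (big_rem k kl).
Qed.

(** The monomial c^(n+1-l) * c_(lambda_1) ... c_(lambda_l) attached to the shape
    lambda of [t]. *)
Definition weight (A : comNzRingType) (c : nat -> A) n (t : seq (seq nat)) : A :=
  c 0%N ^+ (n.+1 - size t) * \prod_(s <- shape t) c s.

Lemma size_syt n t : is_syt n t -> (size t <= n)%N.
Proof.
rewrite is_sytE => /andP[/and3P[t0 _ _] /perm_size]; rewrite size_iota => <-.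
elim: t t0 => //= u t IHt; rewrite inE negb_or eq_sym -size_eq0 size_cat.
case/andP => u0 /IHt; case: (size u) u0 => // m _; rewrite addSn ltnS.
by move=> /leq_trans->; rewrite ?leq_addl.
Qed.

(** Differentiating the power of [c 0] gives the box that starts a new row, and
    differentiating the other factors gives the boxes added to existing rows. *)
Lemma weight_step (A : comNzRingType) (D : A -> A) (c : nat -> A) n t :
    derivation D -> (forall k, D (c k) = c k.+1) -> is_syt n t ->
  c 0%N * D (weight c n t)
    = \sum_(k <- addable t)
        weight c n.+1 (add_box k n.+1 t) *+ sigma (add_box k n.+1 t) n.+1.
Proof.
move=> dD Dc t_syt; have [_ DM] := dD; have szt := size_syt t_syt.
have t_std : standard t by move: t_syt; rewrite is_sytE => /andP[].
have lt_n j : j \in flatten t -> (j < n.+1)%N.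
  by rewrite (mem_flatten_syt _ t_syt) => /andP[].
have t0 : 0%N \notin shape t.
  have /and3P[t0 _ _] := t_std; apply: contra t0.
  by case/mapP => u ut /esym/size0nil <-.
have size_add k : k \in addable t ->
    size (add_box k n.+1 t) = (size (rem k (shape t))).+1.
  by move/(perm_shape_add n.+1 t_std)/perm_size; rewrite size_map.
have prod_add k : k \in addable t ->
    \prod_(s <- shape (add_box k n.+1 t)) c s
      = c k.+1 * \prod_(s <- rem k (shape t)) c s.
  by move=> k_add; rewrite (perm_big _ (perm_shape_add n.+1 t_std k_add)) big_cons.
rewrite /weight DM (derivationX _ _ dD) (derivation_prod _ dD Dc) Dc.
rewrite /addable /= (negPf t0) big_cons.
have z_add : 0%N \in addable t by rewrite mem_addable.
rewrite prod_add // size_add // sigma_add // rem_id // size_map subSS.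
rewrite mulrDr; congr (_ + _).
  by rewrite subSn //= exprS mulrnAl mulrnAr; congr (_ *+ _); ring.
rewrite mulrA -exprS mulr_sumr; apply: eq_big_seq => k; rewrite mem_undup => kt.
have k_add : k \in addable t by rewrite mem_addable kt orbT.
have k0 : k != 0%N by apply: contraNneq t0 => <-.
rewrite prod_add // size_add // sigma_add // (negPf k0) mulrnAr size_rem // size_map.
have t_gt0 : (0 < size t)%N by case: (t) kt.
by rewrite prednK // -subSn // leqW.
Qed.

Lemma iter_derivation_SYT (A : comNzRingType) (D : A -> A) (c : nat -> A) n :
    derivation D -> (forall k, D (c k) = c k.+1) ->
  iter n (fun f => c 0%N * D f) (c 0%N)
    = \sum_(T in SYT n)
        weight c n (rows T) *+ \prod_(1 <= i < n.+1) sigma (rows T) i.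
Proof.
move=> dD Dc; pose F t := weight c n t *+ \prod_(1 <= i < n.+1) sigma t i.
rewrite (sum_SYT n F) {}/F.
elim: n => [|n IHn].
  by rewrite /= big_seq1 /weight big_nil big_geq // expr1 mulr1.
rewrite iterS IHn derivation_sum // mulr_sumr big_allpairs_dep.
apply: eq_big_seq => t; rewrite mem_syts => t_syt.
rewrite derivationMn // mulrnAr (weight_step dD Dc t_syt) -sumrMnl.
apply: eq_bigr => k _; rewrite [in RHS]big_nat_recr //= -mulrnA mulnC.
congr (_ *+ (_ * _)); apply: eq_big_nat => i /andP[_ lt_in].
by rewrite sigma_add_old.
Qed.

(** * Descents and insertion of the maximum *)

Definition insert (i m : nat) (s : seq nat) : seq nat := take i s ++ m :: drop i s.

Definition descents (s : seq nat) : nat :=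
  (\sum_(0 <= k < (size s).-1) (nth 0 s k.+1 < nth 0 s k))%N.

Lemma descents_cons x y s :
  descents (x :: y :: s) = ((y < x) + descents (y :: s))%N.
Proof. by rewrite /descents /= big_nat_recl. Qed.

Lemma descents1 x : descents [:: x] = 0%N.
Proof. by rewrite /descents big_geq. Qed.

Lemma descents_le x s : (descents (x :: s) <= size s)%N.
Proof.
elim: s x => [|y s IHs] x; first by rewrite descents1.
by rewrite descents_cons; exact: (leq_add (leq_b1 _) (IHs y)).
Qed.

(** The induction on a word keeps a letter [x] in front of it, so that no
    insertion happens at the very beginning, where the count is different. Right
    after [x], a descent from [m] to the next letter is created, in place of the
    possible descent after [x]; further insertions leave the latter alone. *)
Lemma sum_insert_behind (V : zmodType) (F : nat -> V) m x s :
    all (fun j => (j < m)%N) (x :: s) ->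
  \sum_(0 <= i < (size s).+1) F (descents (x :: insert i m s))
    = F (descents (x :: s)) *+ (descents (x :: s)).+1
      + F (descents (x :: s)).+1 *+ (size s - descents (x :: s)).
Proof.
elim: s x F => [|y s IHs] x F /= /andP[lt_xm].
  rewrite big_nat1 /insert /= descents_cons !descents1 => _.
  by rewrite ltnNge ltnW //= addr0.
move=> lt_m; have /andP[lt_ym _] := lt_m.
rewrite big_nat_recl //= {1}/insert /= !descents_cons lt_ym ltnNge (ltnW lt_xm) /=.
under eq_bigr => i _ do rewrite descents_cons.
rewrite (IHs y (fun d => F ((y < x) + d)%N)) // add0n.
have := descents_le y s; set d := descents (y :: s) => le_d.
have [_|_] := ltnP y x; rewrite ?add0n add1n.
  by rewrite add1n subSS addrA -mulrS.
by rewrite subSn // (mulrS (F d.+1)) addrCA.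
Qed.

(** Inserting a maximum into a descent or at the end keeps the number of
    descents; at any other place it increases it by one. *)
Lemma sum_insert (V : zmodType) (F : nat -> V) m s :
    all (fun j => (j < m)%N) s ->
  \sum_(0 <= i < (size s).+1) F (descents (insert i m s))
    = F (descents s) *+ (descents s).+1 + F (descents s).+1 *+ (size s - descents s).
Proof.
case: s => [_|x s lt_m].
  by rewrite big_nat1 /insert /= descents1 /descents big_geq // addr0.
have := lt_m => /= /andP[lt_xm _].
rewrite big_nat_recl //= {1}/insert /= descents_cons lt_xm.
rewrite (sum_insert_behind F lt_m) subSn ?descents_le // [in RHS]mulrS.
by rewrite [in RHS](mulrS (F _.+1)) [RHS]addrCA -mulrS.
Qed.

Definition word n (p : 'S_n) : seq nat := [seq val (p i) | i <- enum 'I_n].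

Lemma size_word n (p : 'S_n) : size (word p) = n.
Proof. by rewrite size_map size_enum_ord. Qed.

Lemma nth_word n (p : 'S_n) (i : 'I_n) : nth 0%N (word p) i = p i.
Proof. by rewrite (nth_map i) ?size_enum_ord // nth_ord_enum. Qed.

Lemma des_word n (p : 'S_n) : des p = descents (word p).
Proof.
rewrite /des /descents size_word -sum1_card big_mkcond /=.
case: n p => [|n] p; first by rewrite big_ord0 big_geq.
rewrite big_ord_recr /= inE; case: existsP => [[j /andP[/eqP j_n]]|_].
  by have := ltn_ord j; rewrite j_n ltnn.
rewrite addn0 big_mkord; apply: eq_bigr => i _; rewrite inE.
have := nth_word p (lift ord0 i); have := nth_word p (widen_ord (leqnSn n) i).
rewrite /= => -> -> /=; case: existsP => [[j /andP[/eqP j_i]]|no_j].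
  by rewrite (_ : j = lift ord0 i) => [->|]; last by apply: val_inj.
case: ltnP => // lt_p; case: no_j; exists (lift ord0 i).
by rewrite lift0 /= eqxx.
Qed.

Lemma word_lift_perm n (i : 'I_n.+1) (p : 'S_n) :
  word (lift_perm i ord_max p) = insert i n (word p).
Proof.
have sz_ins : size (insert i n (word p)) = n.+1.
  by rewrite size_cat /= addnS -size_cat cat_take_drop size_word.
have lt_in : (i <= n)%N by rewrite -ltnS.
apply: (@eq_from_nth _ 0%N); first by rewrite size_word sz_ins.
rewrite size_word => k lt_k; have := nth_word (lift_perm i ord_max p) (Ordinal lt_k).
rewrite /= => ->.
rewrite nth_cat size_takel ?size_word //.
case: (unliftP i (Ordinal lt_k)) => [j kE|kE].
  rewrite kE lift_perm_lift lift_max -nth_word.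
  have -> : k = bump i j by have := congr1 val kE.
  rewrite /bump.
  case: (leqP i j) => le_ij; last by rewrite /= ?add0n le_ij nth_take.
  by rewrite /= ?add1n ltnNge leqW //= subSn //= nth_drop subnKC.
rewrite kE lift_perm_id.
have -> : k = i by have := congr1 val kE.
by rewrite ltnn subnn.
Qed.

(** A permutation of n+1 points is given by the position of the maximum and by
    the permutation left after deleting it; injectivity is enough, by counting. *)
Lemma sum_lift_perm (V : nmodType) n (F : 'S_n.+1 -> V) :
  \sum_p F p = \sum_(p : 'S_n) \sum_(i < n.+1) F (lift_perm i ord_max p).
Proof.
pose h (q : 'S_n * 'I_n.+1) := lift_perm q.2 ord_max q.1.
have h_inj : injective h.
  move=> [p i] [q j] /permP/= pq.
  have ij : i = j.
    apply: (@perm_inj _ (h (q, j))); rewrite -pq /h /= !lift_perm_id //.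
  rewrite ij in pq *; congr (_, _); apply/permP => k.
  by have := pq (lift j k); rewrite /h /= !lift_perm_lift => /lift_inj.
have h_bij : bijective h.
  apply: inj_card_bij => //.
  by rewrite card_prod !card_Sn card_ord factS mulnC.
rewrite (reindex h) /=; last exact: onW_bij.
by rewrite (pair_bigA _ (fun p i => F (lift_perm i ord_max p))).
Qed.

Lemma des_le n (p : 'S_n) : (des p <= n)%N.
Proof. by rewrite -[X in (_ <= X)%N]card_ord max_card. Qed.

Lemma sum_des_rec (V : zmodType) n (F : nat -> V) :
  \sum_(p : 'S_n.+1) F (des p)
    = \sum_(p : 'S_n) (F (des p) *+ (des p).+1 + F (des p).+1 *+ (n - des p)).
Proof.
rewrite sum_lift_perm; apply: eq_bigr => p _.
under eq_bigr => i _ do rewrite des_word word_lift_perm.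
have := @sum_insert _ F n (word p); rewrite size_word big_mkord des_word; apply.
by apply/allP => _ /mapP[i _ ->]; apply: ltn_ord.
Qed.

(** * The Eulerian operator xy(d/dx + d/dy) *)

Local Notation x := ('X_0 : {mpoly int[2]}).
Local Notation y := ('X_1 : {mpoly int[2]}).

Definition dxy (f : {mpoly int[2]}) : {mpoly int[2]} :=
  mderiv ord0 f + mderiv (lift ord0 ord0) f.

Lemma mderiv_var (i j : 'I_2) : mderiv i ('X_j : {mpoly int[2]}) = (i == j)%:R.
Proof.
rewrite mderivX mnm1E eq_sym; case: eqP => [->|_]; last by rewrite scale0r.
have -> : (U_(j) - U_(j))%MM = 0%MM.
  by apply/mnmP => k; rewrite mnmBE subnn mnm0E.
by rewrite mpolyX0 scale1r.
Qed.

Lemma dxy_derivation : derivation dxy.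
Proof.
split=> f g; rewrite /dxy; first by rewrite !mderivD; ring.
by rewrite !mderivM; ring.
Qed.

Lemma dxy_x : dxy x = 1.
Proof. by rewrite /dxy !mderiv_var addr0. Qed.

Lemma dxy_y : dxy y = 1.
Proof. by rewrite /dxy !mderiv_var add0r. Qed.

(** The Leibniz rule applied to x^(d+1) y^(n-d) gives d+1 terms in which the
    exponent of y grows and n-d in which that of x does: these are the
    insertions that keep the number of descents, respectively increase it. *)
Lemma eulerian2_rec n : eulerian2 n.+1 = x * y * dxy (eulerian2 n).
Proof.
have dD := dxy_derivation; have [_ DM] := dD.
rewrite /eulerian2 (sum_des_rec n (fun d => x ^+ d.+1 * y ^+ (n.+1 - d))).
rewrite (derivation_sum _ _ dD) mulr_sumr; apply: eq_bigr => p _.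
have := des_le p; move: (des p) => d le_dn.
rewrite DM (derivationX _ _ dD) (derivationX _ _ dD) dxy_x dxy_y !mul1r /=.
rewrite subSS subSn // !exprS.
rewrite mulrnAl mulrnAr mulrDr !mulrnAr; congr (_ *+ _ + _); first by ring.
case: (n - d)%N => [|k] /=; first by rewrite !mulr0n.
by rewrite exprS; congr (_ *+ _); ring.
Qed.

Lemma eulerian2_0 : eulerian2 0 = x.
Proof.
rewrite /eulerian2 (eq_bigr (fun=> x)) => [|p _]; last first.
  by have := des_le p; rewrite leqn0 => /eqP->; rewrite expr0 mulr1.
by rewrite sumr_const card_Sn.
Qed.

Lemma eulerian2_iter n : eulerian2 n = iter n (fun f => x * y * dxy f) x.
Proof. by elim: n => [|n IHn]; rewrite ?eulerian2_0 //= eulerian2_rec IHn. Qed.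

Lemma scaled_derivation (A : comNzRingType) (D : A -> A) (a : A) :
  derivation D -> derivation (fun f => a * D f).
Proof. by case=> DD DM; split=> f g; rewrite ?DD ?DM; ring. Qed.

Lemma weight_const (A : comNzRingType) (a b : A) n t : [::] \notin t ->
  weight (fun k => if k is 0%N then a else b) n t = a ^+ (n.+1 - size t) * b ^+ size t.
Proof.
move=> t0; rewrite /weight; congr (_ * _).
rewrite big_map big_seq (eq_bigr (fun=> b)) => [|u ut].
  by rewrite -big_seq big_const_seq count_predT iter_mulr_1.
by case: u ut t0 => // ->.
Qed.

Lemma rows_standard n T : T \in SYT n -> standard (rows T).
Proof. by rewrite inE is_sytE => /andP[]. Qed.

(** With c = a and D = b(d/dx + d/dy), all the c_k with k > 0 are equal to b, so
    only the number of rows is seen. Stated for both choices of (a, b) as (x, y)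
    or (y, x). *)
Lemma iter_xy_tableaux (a b : {mpoly int[2]}) n :
    a * b = x * y -> dxy a = 1 -> dxy b = 1 ->
  iter n (fun f => x * y * dxy f) a =
    \sum_(T in SYT n) a ^+ (n.+1 - nrows (rows T)) * b ^+ nrows (rows T)
      *+ \prod_(1 <= i < n.+1) sigma (rows T) i.
Proof.
move=> ab da db; pose c k := if k is 0%N then a else b.
have Dc k : b * dxy (c k) = c k.+1 by case: k => [|k] /=; rewrite ?da ?db mulr1.
have -> : iter n (fun f => x * y * dxy f) a
    = iter n (fun f => c 0%N * (b * dxy f)) (c 0%N).
  by apply: eq_iter => f; rewrite mulrA ab.
rewrite (iter_derivation_SYT n (scaled_derivation b dxy_derivation) Dc).
apply: eq_bigr => T /rows_standard/and3P[t0 _ _].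
by rewrite /nrows size_map weight_const.
Qed.

Definition set_y1 : {mpoly int[2]} -> {poly int} :=
  mmap (intr : int -> {poly int}) (fun i : 'I_2 => if i == 0 then 'X else 1).

HB.instance Definition _ := GRing.RMorphism.on set_y1.

Lemma set_y1_x : set_y1 x = 'X.
Proof. by rewrite /set_y1 mmapX mmap1U. Qed.

Lemma set_y1_y : set_y1 y = 1.
Proof. by rewrite /set_y1 mmapX mmap1U. Qed.

Lemma set_y1_eulerian2 n : set_y1 (eulerian2 n) = eulerian n.
Proof.
rewrite /eulerian2 rmorph_sum; apply: eq_bigr => p _.
by rewrite rmorphM !rmorphXn /= set_y1_x set_y1_y expr1n mulr1.
Qed.

(** When c_k = 0 for k > 2, a row of length more than 2 makes the weight vanish;
    otherwise the numbers of rows of length 1 and 2 determine it. *)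
Lemma weight_three (A : comNzRingType) (a b d : A) n t : [::] \notin t ->
  weight (fun k => nth 0 [:: a; b; d] k) n t =
    if all (fun s => s <= 2)%N (shape t) then
      d ^+ nrows_of_size 2 t * a ^+ (n.+1 - nrows_of_size 1 t - nrows_of_size 2 t)
        * b ^+ nrows_of_size 1 t
    else 0.
Proof.
move=> t0; rewrite /weight /nrows_of_size -subnDA.
have -> : \prod_(s <- shape t) [:: a; b; d]`_s =
  if all (fun s => s <= 2)%N (shape t) then
    d ^+ count_mem 2 (shape t) * b ^+ count_mem 1 (shape t) else 0.
  elim: t t0 => [|u t IHt]; first by rewrite big_nil !expr0 mulr1.
  rewrite inE negb_or eq_sym -size_eq0 big_cons /= => /andP[u0 /IHt->].
  case: (size u) u0 => [|[|[|k]]] //= _; rewrite ?nth_nil ?mul0r // !add0n ?add1n.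
    by case: ifP; rewrite ?mulr0 // exprS mulrCA.
  by case: ifP; rewrite ?mulr0 // exprS mulrA.
case: ifP => [le2|_]; last by rewrite mulr0.
have -> : size t = (count_mem 1 (shape t) + count_mem 2 (shape t))%N.
  elim: t t0 le2 => //= u t IHt; rewrite inE negb_or eq_sym -size_eq0.
  move=> /andP[u0 t0] /andP[le_u le_t]; rewrite (IHt t0 le_t).
  by case: (size u) u0 le_u => [|[|[|k]]] //= _ _; rewrite ?add0n ?add1n ?addnS.
by rewrite mulrA (mulrC (_ ^+ (_ - _))).
Qed.

(** The bottom row, which defines [ncols], is the longest. *)
Lemma ncols_le k t : standard t -> (ncols t <= k)%N = all (fun s => s <= k)%N (shape t).
Proof.
case: t => // u t; rewrite standard_cons => /and4P[_ _ /allP ut _] /=.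
apply/idP/andP => [le_uk|[] //]; split=> //.
apply/allP => _ /mapP[v /ut/belowP[le_vu _] ->].
exact: leq_trans le_vu le_uk.
Qed.

Unset Implicit Arguments.

Theorem theorem35 (n : nat) (n_gt0 : (0 < n)%N) :
  [/\ eulerian n =
        \sum_(T in SYT n)
          (\prod_(1 <= i < n.+1) sigma (rows T) i)%:R
            * 'X ^+ (n.+1 - nrows (rows T)),
      eulerian n =
        \sum_(T in SYT n)
          (\prod_(1 <= i < n.+1) sigma (rows T) i)%:R * 'X ^+ nrows (rows T)
    & eulerian2 n.+1 =
        \sum_(T in SYT_le n 2)
          2 ^+ nrows_of_size 2 (rows T)
            * (\prod_(1 <= i < n.+1) sigma (rows T) i)%:R
            * ('X_0 * 'X_1)
                ^+ (n.+1 - nrows_of_size 1 (rows T) - nrows_of_size 2 (rows T))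
            * ('X_0 + 'X_1) ^+ nrows_of_size 1 (rows T)].
Proof.
split.
- rewrite -set_y1_eulerian2 eulerian2_iter (@iter_xy_tableaux x y) ?dxy_x ?dxy_y //.
  rewrite rmorph_sum; apply: eq_bigr => T _.
  by rewrite rmorphMn rmorphM !rmorphXn /= set_y1_x set_y1_y expr1n mulr1 mulr_natl.
- (* E x = E y, so the two iterations agree after one step; this is where *)
  (* n > 0 is needed.                                                     *)
  have eul_y : eulerian2 n = iter n (fun f => x * y * dxy f) y.
    case: n n_gt0 => // m _; rewrite eulerian2_iter !iterSr.
    by rewrite dxy_x dxy_y.
  rewrite -set_y1_eulerian2 eul_y.
  rewrite (@iter_xy_tableaux y x) ?dxy_x ?dxy_y ?[y * x]mulrC //.
  rewrite rmorph_sum; apply: eq_bigr => T _.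
  by rewrite rmorphMn rmorphM !rmorphXn /= set_y1_x set_y1_y expr1n mul1r mulr_natl.
pose c k : {mpoly int[2]} := nth 0 [:: x * y; x + y; 2] k.
have Dc k : dxy (c k) = c k.+1.
  have dD := dxy_derivation; have [DD DM] := dD.
  case: k => [|[|[|k]]] /=; rewrite /c /= ?DM ?DD ?dxy_x ?dxy_y ?mul1r ?mulr1 //.
  - by rewrite addrC.
  - by rewrite (derivation1 dD) addr0.
  by rewrite nth_nil (derivation0 dD).
have -> : eulerian2 n.+1 = iter n (fun f => c 0%N * dxy f) (c 0%N).
  (* The first application of E turns x into xy, which shifts the index. *)
  by rewrite eulerian2_iter iterSr dxy_x mulr1.
rewrite (iter_derivation_SYT n dxy_derivation Dc) [RHS]big_mkcond [LHS]big_mkcond /=.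
apply: eq_bigr => T _; rewrite [T \in SYT_le n 2]inE.
case: ifP => //= T_in; have T_std := rows_standard T_in.
have /and3P[t0 _ _] := T_std; rewrite ncols_le // weight_three //.
case: ifP => _; last by rewrite mul0rn.
by rewrite -[LHS]mulr_natr mulrAC; congr (_ * _); rewrite mulrAC.
Qed.
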